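(* Let $d\ge3$ and let $C$ be a $d$-dimensional Archimedean copula with generator $\psi$, pseudo-inverse $\varphi$ and Williamson measure $\gamma$. Then $\mu_C(L_t)=\gamma(\{1/\varphi(t)\})$ for every $t\in(0,1]$. If $C$ is strict then $\mu_C(L_0)=0$, and if $C$ is non-strict then $\mu_C(L_0)=\gamma(\{1/\varphi(0)\})$. Finally, the Kendall distribution function satisfies $F_K^d(t)=\gamma([0,1/\varphi(t)])$ for every $t\in(0,1]$.
   Context: An Archimedean generator is a continuous non-increasing $\psi:[0,\infty)\to[0,1]$ with $\psi(0)=1$, $\lim_{z\to\infty}\psi(z)=0$, strictly decreasing on $[0,\inf\{z:\psi(z)=0\}]$, normalized by $\psi(1)=1/2$; pseudo-inverse $\varphi(y)=\inf\{z\in[0,\infty]:\psi(z)=y\}$. $C(\mathbf{u})=\psi(\sum_{i=1}^d\varphi(u_i))$ is a $d$-dimensional Archimedean copula iff $(-1)^{d-2}\psi^{(d-2)}$ exists on $(0,\infty)$ and is non-negative, non-increasing and convex. $C$ is strict if $\varphi(0)=\infty$. The Williamson measure of $\psi$ is the unique probability measure $\gamma$ on $\mathcal{B}([0,\infty))$ with $\gamma(\{0\})=0$ and $\psi(z)=\int_{[0,\infty)}(1-tz)_+^{d-1}\,d\gamma(t)$ for $z>0$. $\mu_C$ is the probability measure on $[0,1]^d$ with distribution function $C$. Level sets: $L_t=\{\mathbf{u}\in[0,1]^d:C(\mathbf{u})=t\}$ for $t\in[0,1]$. The Kendall distribution function is $F_K^d(t)=\mu_C(\{\mathbf{u}:C(\mathbf{u})\le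 t\})$. Convention $1/0=\infty$ (so $F_K^d(1)=\gamma([0,\infty))$). *)

(* Defs.v *)
From HB Require Import structures.
From mathcomp Require Import all_boot all_order all_algebra.
From mathcomp Require Import all_classical all_reals all_analysis.
Unset Printing Implicit Defensive.
Import Order.TTheory GRing.Theory Num.Theory.
Import numFieldNormedType.Exports.
Local Open Scope classical_set_scope.
Local Open Scope ring_scope.

Section Archimedean.
Variable R : realType.

(* Archimedean generator psi : [0,oo) -> [0,1] (values on negative reals irrelevant). *)
Definition zero_point (psi : R -> R) : \bar R :=
  ereal_inf [set z%:E | z in [set z : R | 0 <= z /\ psi z = 0]].

Definition is_generator (psi : R -> R) : Prop :=
  [/\ {within [set z : R | 0 <= z], continuous psi},
      (forall x y : R, 0 <= x -> x <= y -> psi y <= psi x),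
      (forall z : R, 0 <= z -> 0 <= psi z <= 1),
      psi 0 = 1
    & [/\ psi z @[z --> +oo] --> (0 : R),
      (forall x y : R, 0 <= x -> x < y -> (y%:E <= zero_point psi)%E -> psi y < psi x)
    & psi 1 = 2^-1]].

(* pseudo-inverse phi(y) = inf {z in [0,oo] : psi z = y}, valued in [0,+oo];
   psi(+oo) = 0, and the infimum of the empty set is +oo. *)
Definition phi (psi : R -> R) (y : R) : \bar R :=
  ereal_inf [set z%:E | z in [set z : R | 0 <= z /\ psi z = y]].

Definition psi_ext (psi : R -> R) (x : \bar R) : R :=
  match x with
  | r%:E => psi r
  | +oo%E => 0
  | -oo%E => 1
  end.

Definition einv (x : \bar R) : \bar R :=
  match x with
  | r%:E => if r == 0 then +oo%E else (r^-1)%:E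
  | _ => 0%E
  end.

Definition archimedean_copula_cond (d : nat) (psi : R -> R) : Prop :=
  let n := (d - 2)%N in
  let g := fun x : R => (-1) ^+ n * (derive1n n psi) x in
  [/\ (forall k : nat, (k < n)%N -> forall x : R, 0 < x -> derivable (derive1n k psi) x 1),
      (forall x : R, 0 < x -> 0 <= g x),
      (forall x y : R, 0 < x -> x <= y -> g y <= g x)
    & (forall x y l : R, 0 < x -> 0 < y -> 0 <= l <= 1 ->
         g (l * x + (1 - l) * y) <= l * g x + (1 - l) * g y)].

Definition strict (psi : R -> R) : Prop := phi psi 0 = +oo%E.

Definition arch_copula (d : nat) (psi : R -> R) (u : 'I_d -> R) : R :=
  psi_ext psi (\sum_(i < d) phi psi (u i))%E.

(* Williamson measure: probability on B([0,oo)) (seen as a probability on R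
   carried by [0,oo)) with no atom at 0 and psi(z) = int (1 - t z)_+^(d-1) dgamma(t) *)
Definition williamson_measure (d : nat) (psi : R -> R) (gamma : probability R R) : Prop :=
  [/\ gamma [set t : R | 0 <= t] = 1%E,
      gamma [set 0] = 0%E
    & forall z : R, 0 < z ->
        (psi z)%:E = (\int[gamma]_(t in [set t : R | (0 <= t)%R])
                         (@GRing.exp R (Num.max (1 - t * z)%R 0%R) (d - 1))%:E)%E].

(* Borel sigma-algebra on R^d, generated by the lower orthants *)
Definition orthants (d : nat) : set (set ('I_d -> R)) :=
  [set [set x : 'I_d -> R | forall i, x i <= a i] | a in [set: 'I_d -> R]].

Definition Rd (d : nat) := g_sigma_algebraType (orthants d).

Definition unit_cube (d : nat) : set ('I_d -> R) :=
  [set u | forall i, 0 <= u i <= 1].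

Definition copula_measure (d : nat) (psi : R -> R) (mu : probability (Rd d) R) : Prop :=
  mu (unit_cube d : set (Rd d)) = 1%E /\
  forall u : 'I_d -> R, unit_cube d u ->
    mu ([set x | forall i, 0 <= x i <= u i] : set (Rd d)) = (arch_copula d psi u)%:E.

Definition level_set (d : nat) (psi : R -> R) (t : R) : set (Rd d) :=
  [set u | unit_cube d u /\ arch_copula d psi u = t].

Definition kendall_df (d : nat) (psi : R -> R) (mu : probability (Rd d) R) (t : R) : \bar R :=
  mu ([set u | unit_cube d u /\ arch_copula d psi u <= t] : set (Rd d)).

End Archimedean.

Arguments zero_point {R}. Arguments is_generator {R}. Arguments phi {R}.
Arguments psi_ext {R}. Arguments einv {R}. Arguments archimedean_copula_cond {R}.
Arguments strict {R}. Arguments arch_copula {R}. Arguments williamson_measure {R}.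
Arguments unit_cube {R}. Arguments copula_measure {R}. Arguments level_set {R}.
Arguments kendall_df {R}.

(* Main.v *)
(** With X_i = phi(U_i), the survival function of X under mu_C is psi(x_1 + ... + x_d),
so a cube of side h and lower corner a has X-mass equal to the d-th finite difference
of psi at |a|, which by the Williamson representation is the gamma(dt)-integral of the
d-th difference of x |-> (1 - t x)_+^(d-1).  That difference is a B-spline in x: it is
nonnegative and lives on t x < 1 <= t (x + d h).  Summed over all cells of a grid
covering the simplex {t |x| < 1} it gives 1.  Hence, up to an error d h, the mass
gamma(dt) sits on the cells with |x| = 1/t; letting h go to 0, Z = X_1 + ... + X_d has
the law of 1/t under gamma.  All the claims are then read off C(U) = psi(Z). *)

Require Import Defs.
From HB Require Import structures.
From mathcomp Require Import all_boot all_order all_algebra.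
From mathcomp Require Import all_classical all_reals all_analysis.
From mathcomp Require Import measurable_realfun.
From mathcomp Require Import ring lra.
Import Order.TTheory GRing.Theory Num.Theory.
Import numFieldNormedType.Exports.
Local Open Scope classical_set_scope.
Local Open Scope ring_scope.

(** * Finite differences of truncated powers *)

(** This iterates [f x - f (x + h)], hence is [(-1)^n] times the forward difference: the sign for
    which the differences below are nonnegative. *)
Fixpoint fdiff {R : nzRingType} (h : R) (n : nat) (f : R -> R) (x : R) : R :=
  if n is n'.+1 then fdiff h n' f x - fdiff h n' f (x + h) else f x.

(** The cutoff is a test rather than a maximum, so that exponent 0 gives the indicator of [t x < 1],
    the degree-0 spline that starts the induction. *)
Definition trpow {R : numDomainType} (t : R) (n : nat) (x : R) : R :=
  if t * x < 1 then (1 - t * x) ^+ n else 0.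

Section FiniteDifferences.
Variable R : realFieldType.
Implicit Types (t h x : R) (f q : R -> R).

Lemma eq_fdiff h n f q : f =1 q -> fdiff h n f =1 fdiff h n q.
Proof. by move=> fq; elim: n => [|n IH] x //=; rewrite !IH. Qed.

(** Leibniz rule: the factor [1 - t y] is affine, so its differences beyond the first, which is
    [t h], vanish and only two terms survive. *)
Lemma fdiff_mul_affine t h n q x :
  fdiff h n.+1 (fun y => (1 - t * y) * q y) x =
  (1 - t * x) * fdiff h n.+1 q x + n.+1%:R * (t * h) * fdiff h n q (x + h).
Proof.
elim: n x => [|n IH] x; first by rewrite /=; ring.
have E f y : fdiff h n.+2 f y = fdiff h n.+1 f y - fdiff h n.+1 f (y + h) by [].
rewrite E !IH [fdiff h n.+2 q x]E -[in n.+2%:R]natr1.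
have -> : fdiff h n.+1 q (x + h) = fdiff h n q (x + h) - fdiff h n q (x + h + h) by [].
by ring.
Qed.

Lemma trpow_maxE t n x : (0 < n)%N -> Num.max (1 - t * x) 0 ^+ n = trpow t n x.
Proof.
move=> n0; rewrite /trpow; case: ltP => tx1.
  by rewrite max_l// subr_ge0 ltW.
by rewrite max_r ?subr_le0// expr0n; case: n n0.
Qed.

Lemma trpowS t n x : trpow t n.+1 x = (1 - t * x) * trpow t n x.
Proof. by rewrite /trpow; case: ifP; rewrite ?exprS ?mulr0. Qed.

(* [fdiff h n.+1 (trpow t n)] is a multiple of the B-spline of degree [n] with
   knots [1/t - i h]; the induction is the Cox-de Boor recurrence. *)
Lemma fdiff_trpow t h n x : 0 <= t -> 0 <= h ->
  0 <= fdiff h n.+1 (trpow t n) x /\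
  (fdiff h n.+1 (trpow t n) x != 0 -> t * x < 1 <= t * (x + n.+1%:R * h)).
Proof.
move=> t0 h0; elim: n x => [|n IH] x.
  rewrite /= /trpow mul1r !expr0; have := mulr_ge0 t0 h0.
  case: ltP => tx; case: ltP => txh th0; rewrite ?subrr ?eqxx ?subr0 ?ler01 //.
  by move: tx txh; rewrite mulrDr; lra.
have -> : fdiff h n.+2 (trpow t n.+1) x =
    (1 - t * x) * fdiff h n.+1 (trpow t n) x
    + (t * (x + n.+2%:R * h) - 1) * fdiff h n.+1 (trpow t n) (x + h).
  rewrite (eq_fdiff _ _ _ (fun y => (1 - t * y) * trpow t n y)); last exact: trpowS.
  rewrite fdiff_mul_affine -/fdiff.
  have -> : fdiff h n.+2 (trpow t n) x
    = fdiff h n.+1 (trpow t n) x - fdiff h n.+1 (trpow t n) (x + h) by [].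
  by ring.
have [a0 aN] := IH x; have [b0 bN] := IH (x + h).
move: a0 aN b0 bN; set a := fdiff _ _ _ x; set b := fdiff _ _ _ (x + h).
have th0 := mulr_ge0 t0 h0.
have nth0 : 0 <= n.+1%:R * (t * h) by rewrite mulr_ge0// ler0n.
have E1 : t * (x + n.+1%:R * h) = t * x + n.+1%:R * (t * h) by ring.
have E2 : t * (x + n.+2%:R * h) = t * x + n.+1%:R * (t * h) + t * h.
  by rewrite -(natr1 n.+1); ring.
have E3 : t * (x + h + n.+1%:R * h) = t * x + n.+1%:R * (t * h) + t * h by ring.
have E4 : t * (x + h) = t * x + t * h by ring.
rewrite E1 E2 E3 E4 => a0 aN b0 bN.
(* The coefficient of [a] or [b] is known to be nonnegative only where that spline is nonzero, hence
   the case split. *)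
have [a_eq0|aneq0] := eqVneq a 0; have [b_eq0|bneq0] := eqVneq b 0.
- by rewrite a_eq0 b_eq0 !mulr0 addr0 eqxx.
- have /andP[b1 b2] := bN bneq0.
  rewrite a_eq0 mulr0 add0r; split; first by rewrite mulr_ge0//; lra.
  by move=> _; apply/andP; split; lra.
- have /andP[a1 a2] := aN aneq0.
  rewrite b_eq0 mulr0 addr0; split; first by rewrite mulr_ge0//; lra.
  by move=> _; apply/andP; split; lra.
- have /andP[a1 a2] := aN aneq0; have /andP[b1 b2] := bN bneq0.
  split; first by rewrite addr_ge0// mulr_ge0//; lra.
  by move=> _; apply/andP; split; lra.
Qed.

(** The linear functional sending [X^i] to [f i]. Multiplication by [X] becomes a shift, so
    polynomial identities turn into identities between finite differences. *)
Definition umbral f (p : {poly R}) : R := \sum_(i < size p) p`_i * f i%:R.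

Lemma umbral_widen f (p : {poly R}) n : (size p <= n)%N ->
  umbral f p = \sum_(i < n) p`_i * f i%:R.
Proof.
move=> pn; rewrite /umbral (big_ord_widen n (fun i => p`_i * f i%:R))//.
rewrite [RHS](bigID (fun i : 'I_n => (i < size p)%N))/= [X in _ = _ + X]big1 ?addr0// => i.
by rewrite -leqNgt => /(nth_default 0) ->; rewrite mul0r.
Qed.

Lemma umbralD f (p q : {poly R}) : umbral f (p + q) = umbral f p + umbral f q.
Proof.
set n := maxn (size p) (size q).
rewrite (umbral_widen f (p + q) n) ?size_polyD// (umbral_widen f p n) ?leq_maxl//.
rewrite (umbral_widen f q n) ?leq_maxr// -big_split/=.
by apply: eq_bigr => i _; rewrite coefD mulrDl.
Qed.

Lemma umbralN f p : umbral f (- p) = - umbral f p.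
Proof.
rewrite /umbral size_polyN -sumrN; apply: eq_bigr => i _.
by rewrite coefN mulNr.
Qed.

Lemma umbral0 f : umbral f 0 = 0.
Proof. by rewrite /umbral size_poly0 big_ord0. Qed.

Lemma umbral_sum f (I : Type) (r : seq I) (P : pred I) (F : I -> {poly R}) :
  umbral f (\sum_(i <- r | P i) F i) = \sum_(i <- r | P i) umbral f (F i).
Proof. by apply: (big_morph (umbral f)); [exact: umbralD | exact: umbral0]. Qed.

Lemma umbralXn f m : umbral f 'X^m = f m%:R.
Proof.
rewrite /umbral size_polyXn big_ord_recr/= coefXn eqxx mul1r big1 ?add0r//.
by move=> i _; rewrite coefXn ltn_eqF ?mul0r.
Qed.

Lemma umbral_fdiff f h n m :
  umbral (fun y => f (y * h)) ('X^m * (1 - 'X) ^+ n) = fdiff h n f (m%:R * h).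
Proof.
elim: n m => [|n IH] m; first by rewrite expr0 mulr1 umbralXn.
rewrite exprSr mulrA mulrBr mulr1 umbralD umbralN IH/=; congr (_ - _).
by rewrite -mulrA [_ * 'X]mulrC mulrA -exprSr IH -natr1 mulrDl mul1r.
Qed.

Lemma umbralXnM f M p : (forall m, (M <= m)%N -> f m%:R = 0) ->
  umbral f ('X^M * p) = 0.
Proof.
move=> f0; rewrite /umbral big1// => i _; rewrite coefXnM.
by case: ltnP => iM; rewrite ?mul0r// f0 ?mulr0.
Qed.

(* [(1 + X + ... + X^(M-1))^n (1 - X)^n = (1 - X^M)^n], read through the linear
   functional [umbral]. *)
Lemma sum_box_fdiff f h n M : (forall m, (M <= m)%N -> f (m%:R * h) = 0) ->
  \sum_(k : {ffun 'I_n -> 'I_M}) fdiff h n f ((\sum_i (k i : nat))%:R * h) = f 0.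
Proof.
move=> f0.
under eq_bigr do rewrite -umbral_fdiff.
rewrite -umbral_sum -mulr_suml.
(* Expanding the [n]-th power chooses one exponent per coordinate, that is, one multi-index [k] of
   the box. *)
have -> : \sum_(k : {ffun 'I_n -> 'I_M}) 'X^(\sum_i (k i : nat)) =
    (\sum_(j < M) 'X^j) ^+ n :> {poly R}.
  under eq_bigr do rewrite expr_sum.
  rewrite -(bigA_distr_bigA (fun (i : 'I_n) (j : 'I_M) => 'X^j : {poly R}))/=.
  by rewrite prodr_const card_ord.
rewrite -exprMn -[_ * (1 - 'X)]mulrC.
have -> : (1 - 'X) * (\sum_(j < M) 'X^j) = 1 - 'X^M :> {poly R}.
  rewrite -[RHS]opprB subrX1 -mulNr opprB; congr (_ * _).
(* All terms but the constant 1 are multiples of [X^M], where [f] already vanishes. *)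
have [q ->] : exists q : {poly R}, (1 - 'X^M) ^+ n = 1 + 'X^M * q.
  elim: n => [|n [q IH]]; first by exists 0; rewrite expr0 mulr0 addr0.
  by exists (q - 1 - 'X^M * q); rewrite exprS IH; ring.
rewrite umbralD umbralXnM//.
by rewrite -[1](expr0 'X) umbralXn mul0r addr0.
Qed.

End FiniteDifferences.

(** * Probability measures on the line *)

Lemma probability_setI_full d (T : measurableType d) (R : realType)
    (P : probability T R) (S A : set T) :
  measurable S -> measurable A -> P S = 1%E -> P A = P (A `&` S).
Proof.
move=> mS mA PS; have mSC : measurable (~` S) by exact: measurableC.
have PSC : P (~` S) = 0%E by rewrite probability_setC// PS subee.
have mAS : measurable (A `&` S) by exact: measurableI.
have mASC : measurable (A `&` ~` S) by exact: measurableI.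
rewrite -[in LHS](setIT A) -(setUv S) setIUr measureU0//.
exact: subset_measure0 PSC.
Qed.

Section RealProbabilities.
Variable R : realType.
Implicit Types P Q : probability R R.

(** The slack [h] disappears by continuity from above: the rays from [s - 1/(n+1)] shrink to the
    closed ray from [s]. *)
Lemma probability_upper_le P Q :
  (forall s h : R, 0 < h -> (Q `[s, +oo[%classic <= P `[(s - h)%R, +oo[%classic)%E) ->
  forall s, (Q `[s, +oo[%classic <= P `[s, +oo[%classic)%E.
Proof.
move=> PQ s.
pose F (n : nat) : set R := `[(s - n.+1%:R^-1)%R, +oo[%classic.
have mF n : measurable (F n) by exact: measurable_itv.
have FE : \bigcap_n F n = `[s, +oo[%classic.
  apply/seteqP; split=> x /=; last first.
    rewrite in_itv/= andbT => sx n _; rewrite /F/= in_itv/= andbT.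
    by rewrite (le_trans _ sx)// gerBl.
  move=> Fx; rewrite in_itv/= andbT; apply/ler_addgt0Pr => e e0.
  have [n ne] : exists n : nat, n.+1%:R^-1 < e.
    by exists (Num.truncn e^-1); rewrite invf_plt ?posrE// truncnS_gt.
  have := Fx n I; rewrite /F/= in_itv/= andbT lerBlDr => /le_trans; apply.
  by rewrite lerD2l ltW.
have cvgF : P \o F @ \oo --> P (\bigcap_n F n).
  apply: nonincreasing_cvg_mu => //.
  - apply: (@le_lt_trans _ _ 1%E); [by apply: probability_le1 | exact: ltry].
  - by apply: bigcap_measurableType => n _; exact: measurable_itv.
  - move=> m n mn; apply/subsetPset => x; rewrite /F/= !in_itv/= !andbT.
    by apply: le_trans; rewrite lerB// lef_pV2 ?posrE// ler_nat.
rewrite -[X in (_ <= P X)%E]FE -(cvg_lim _ cvgF)//; apply: lime_ge.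
  by apply/cvg_ex; eexists; exact: cvgF.
by apply: nearW => n /=; apply: PQ; rewrite invr_gt0.
Qed.

Lemma eq_probability_upper P Q :
  (forall s, P `[s, +oo[%classic = Q `[s, +oo[%classic) ->
  forall A, measurable A -> P A = Q A.
Proof.
move=> PQ; apply: (measure_unique (@measurable_realfun.RGenCInfty.G R)
  (fun n : nat => `[- n%:R, +oo[%classic)).
- exact: measurable_realfun.RGenCInfty.measurableE.
- move=> _ _ [a ->] [b ->]; exists (Num.max a b); apply/seteqP; split=> x /=.
    by rewrite !in_itv/= !andbT ge_max => -[-> ->].
  by rewrite !in_itv/= !andbT ge_max => /andP.
- by move=> n; eexists.
- apply/seteqP; split=> // x _; exists (Num.truncn (- x)).+1 => //=.
  by rewrite in_itv/= andbT lerNl ltW// truncnS_gt.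
- by move=> A [x ->]; exact: PQ.
- move=> k; apply: (@le_lt_trans _ _ 1%E); [by apply: probability_le1 | exact: ltry].
Qed.

(** A finite grid reaches only bounded levels; continuity from below along [N h] removes the
    truncation. *)
Lemma probability_le_truncated P (B : set R) (h : R) (c : \bar R) : 0 < h ->
  measurable B ->
  (forall N : nat, (P (B `&` `]-oo, (N%:R * h)%R]) <= c)%E) -> (P B <= c)%E.
Proof.
move=> h0 mB Bc.
pose F (N : nat) := B `&` `]-oo, (N%:R * h)%R]%classic.
have mF N : measurable (F N) by exact: measurableI.
have FE : \bigcup_N F N = B.
  apply/seteqP; split=> [x [N _ []]//|x Bx].
  exists (Num.truncn (x / h)).+1 => //; split => //=.
  by rewrite in_itv/= -ler_pdivrMr// ltW// truncnS_gt.
have cvgF : P \o F @ \oo --> P (\bigcup_n F n).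
  apply: nondecreasing_cvg_mu => //; first exact: bigcup_measurable.
  move=> m n mn; apply/subsetPset => x [Bx]; rewrite /F/= !in_itv/= => xm.
  by split=> //; rewrite (le_trans xm)// ler_pM2r// ler_nat.
rewrite -[X in (P X <= _)%E]FE -(cvg_lim _ cvgF)//; apply: lime_le.
  by apply/cvg_ex; eexists; exact: cvgF.
by apply: nearW => n /=; exact: Bc.
Qed.

End RealProbabilities.

(** * Archimedean generators *)

Section Generator.
Variables (R : realType) (psi : R -> R).
Hypothesis psi_gen : is_generator psi.

Lemma psi0 : psi 0 = 1.
Proof. by case: psi_gen. Qed.

Lemma psi_noninc x y : 0 <= x -> x <= y -> psi y <= psi x.
Proof. by case: psi_gen => _ h _ _ _; exact: h. Qed.

Lemma psi_ge0 x : 0 <= x -> 0 <= psi x.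
Proof. by case: psi_gen => _ _ h _ _ /h/andP[]. Qed.

Lemma psi_le1 x : 0 <= x -> psi x <= 1.
Proof. by case: psi_gen => _ _ h _ _ /h/andP[]. Qed.

(** [is_generator] gives strictness up to [zero_point]; if [y] lies beyond it, some zero precedes
    [y] and forces [psi y <= 0 < psi x]. *)
Lemma psi_decr x y : 0 <= x -> x < y -> 0 < psi x -> psi y < psi x.
Proof.
move=> x0 xy px0; have [yz|zy] := leP y%:E (zero_point psi).
  by case: psi_gen => _ _ _ _ [_ h _]; exact: h.
have [_ [z [z0 pz0] <-]] := ereal_inf_lt zy; rewrite lte_fin => zy'.
by apply: le_lt_trans px0; rewrite -pz0 psi_noninc// ltW.
Qed.

Lemma psi_inj x y : 0 <= x -> 0 <= y -> 0 < psi x -> psi x = psi y -> x = y.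
Proof.
move=> x0 y0 px E; have [xy|yx|//] := ltgtP x y.
  by have := psi_decr _ _ x0 xy px; rewrite E ltxx.
by have := psi_decr _ _ y0 yx; rewrite -E ltxx => /(_ px).
Qed.

Lemma psi_surj u : 0 < u <= 1 -> exists2 x, 0 <= x & psi x = u.
Proof.
move=> /andP[u0 u1]; case: psi_gen => cpsi _ _ _ [psiy _ _].
have [y y0 yu] : exists2 y, 0 <= y & psi y < u.
  have : \forall y \near +oo, psi y < u by apply: (cvgr_lt (0 : R)).
  move=> /(filterI (nbhs_pinfty_ge (num_real (0:R)))) /filter_ex[y [/= y0 yu]].
  by exists y.
have cy : {within `[0, y], continuous psi}.
  apply: continuous_subspaceW cpsi => x /=; rewrite in_itv/= => /andP[]//.
have [|x] := IVT y0 cy (v := u).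
  rewrite psi0 min_r ?max_l ?psi_le1//.
  by rewrite (ltW yu) u1.
by rewrite in_itv/= => /andP[x0 _] xu; exists x.
Qed.

Lemma phi_ge0 u : (0 <= phi psi u)%E.
Proof. by apply: le_ereal_inf_tmp => _ [z [z0 _] <-]; rewrite lee_fin. Qed.

Lemma phi_psi x : 0 <= x -> 0 < psi x -> phi psi (psi x) = x%:E.
Proof.
move=> x0 px; rewrite /phi.
have -> : [set z : R | 0 <= z /\ psi z = psi x] = [set x].
  apply/seteqP; split=> z /=; last by move=> ->.
  by move=> [z0 E]; apply: psi_inj; rewrite ?E.
by rewrite image_set1 ereal_inf1.
Qed.

Lemma psi_gt0_lt_zero x z : 0 <= z -> 0 < psi x -> psi z = 0 -> x < z.
Proof.
by move=> z0 px pz; rewrite ltNge; apply/negP => /(psi_noninc _ _ z0); rewrite pz leNgt px.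
Qed.

(** The infimum is attained: were [psi r] positive, a point [x] of value [psi r / 2] would lie below
    every zero, hence [x <= r], against monotonicity. *)
Lemma phi0_finE r : phi psi 0 = r%:E -> 0 < r /\ psi r = 0.
Proof.
move=> E; have r0 : 0 <= r by rewrite -lee_fin -E phi_ge0.
have above x : 0 <= x -> 0 < psi x -> x <= r.
  move=> x0 px; rewrite -lee_fin -E; apply: le_ereal_inf_tmp => _ [z [z0 pz] <-].
  by rewrite lee_fin ltW// psi_gt0_lt_zero.
suff pr : psi r = 0.
  split=> //; rewrite lt_neqAle r0 andbT.
  by apply: contra_eq_neq pr => <-; rewrite psi0 oner_neq0.
apply/eqP; rewrite eq_le psi_ge0// andbT leNgt; apply/negP => pr.
have [|x x0 px] := psi_surj (psi r / 2).
  by rewrite divr_gt0//= ler_pdivrMr//; have := psi_le1 r r0; lra.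
have xr : x <= r by apply: above => //; rewrite px divr_gt0.
by have := psi_noninc _ _ x0 xr; rewrite px; lra.
Qed.

Lemma phi0_pinftyE x : phi psi 0 = +oo%E -> 0 <= x -> 0 < psi x.
Proof.
move=> E x0; rewrite lt_neqAle psi_ge0// andbT eq_sym; apply/eqP => px.
have : (phi psi 0 <= x%:E)%E by apply: ge_ereal_inf; exists x%:E => //; exists x.
by rewrite E leye_eq.
Qed.

Lemma psi_ext_ge_phi0 y : (phi psi 0 <= y)%E -> psi_ext psi y = 0.
Proof.
case E : (phi psi 0) (phi_ge0 0) => [r| |//] _; last by rewrite leye_eq => /eqP ->.
have [r0 pr] := phi0_finE _ E.
case: y => [y| |]//=; rewrite lee_fin => ry.
apply/eqP; rewrite eq_le psi_ge0 ?(le_trans (ltW r0))// andbT -pr.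
exact: psi_noninc (ltW r0) ry.
Qed.

Lemma arch_copula_eq0 d (u : 'I_d -> R) i : u i = 0 -> arch_copula d psi u = 0.
Proof.
move=> ui0; apply: psi_ext_ge_phi0; rewrite (bigD1 i)//= ui0 leeDl//.
by apply: sume_ge0 => j _; exact: phi_ge0.
Qed.

(** If some [psi (a i)] is 0, [phi] may return less than [a i], but then both sides vanish;
    otherwise [phi] inverts [psi] in every coordinate. *)
Lemma arch_copula_psi d (a : 'I_d -> R) : (forall i, 0 <= a i) ->
  arch_copula d psi (psi \o a) = psi (\sum_i a i).
Proof.
move=> a0; have [/forallP pos|] := boolP [forall i, 0 < psi (a i)].
  by rewrite /arch_copula (eq_bigr (EFin \o a)) ?sumEFin// => i _; rewrite /= phi_psi.
rewrite negb_forall => /existsP[i]; rewrite -leNgt => pi.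
have pi0 : psi (a i) = 0 by apply/eqP; rewrite eq_le pi psi_ge0.
rewrite (arch_copula_eq0 _ _ i)//; apply/esym/eqP.
rewrite eq_le psi_ge0 ?sumr_ge0// andbT -[leRHS]pi0 psi_noninc//.
by rewrite (bigD1 i)//= lerDl sumr_ge0.
Qed.

(** A real-valued [phi]. The default 0 also covers [u = 0], where [phi] may be infinite; points with
    such a coordinate lie on faces of measure zero. *)
Definition rphi (u : R) : R := if 0 < u <= 1 then fine (phi psi u) else 0.

Lemma rphi_ge0 u : 0 <= rphi u.
Proof. by rewrite /rphi; case: ifP => // _; rewrite fine_ge0// phi_ge0. Qed.

Lemma rphiP u : 0 < u <= 1 -> phi psi u = (rphi u)%:E /\ psi (rphi u) = u.
Proof.
move=> u01; rewrite /rphi u01; have [x x0 xu] := psi_surj _ u01.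
by rewrite -xu phi_psi// xu; case/andP : u01.
Qed.

Lemma le_rphi u r : 0 < u <= 1 -> 0 <= r -> (r <= rphi u) = (u <= psi r).
Proof.
move=> u01 r0; have [_ E] := rphiP _ u01; apply/idP/idP => h.
  by rewrite -[leLHS]E psi_noninc.
rewrite leNgt; apply/negP => rr.
have : psi r < psi (rphi u) by apply: psi_decr; rewrite ?rphi_ge0// E; case/andP : u01.
by rewrite E ltNge h.
Qed.

Lemma measurable_rphi : measurable_fun setT rphi.
Proof.
apply: (measurability (@measurable_realfun.RGenCInfty.G R)) => [|/= _ [_] [r] -> <-].
  exact: measurable_realfun.RGenCInfty.measurableE.
(* The default 0 puts every [u] in the preimage when [r <= 0] and excludes all [u] outside []0, 1]]
   when [r > 0]. *)
rewrite setTI; have [r0|r0] := leP r 0.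
  rewrite (_ : _ @^-1` _ = setT)//; apply/seteqP; split=> // u _ /=.
  by rewrite in_itv/= andbT (le_trans r0)// rphi_ge0.
rewrite (_ : _ @^-1` _ = `]0, psi r]%classic); first exact: measurable_itv.
apply/seteqP; split=> u /=; rewrite !in_itv/= ?andbT.
  have [u01|u01] := boolP (0 < u <= 1); last by rewrite /rphi (negbTE u01) leNgt r0.
  by rewrite (le_rphi _ _ u01 (ltW r0)) => ur; case/andP : (u01) => -> _.
move=> /andP[u0 ur]; rewrite le_rphi// ?(ltW r0)// u0/= (le_trans ur)//.
by rewrite psi_le1 ?ltW.
Qed.

End Generator.

(** * Finite differences of the Williamson transform *)

Section Williamson.
Variables (R : realType) (d : nat) (psi : R -> R) (gamma : probability R R).
Hypothesis d_gt1 : (1 < d)%N.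
Hypothesis psi_gen : is_generator psi.
Hypothesis gammaP : williamson_measure d psi gamma.

Let D : set R := [set t | 0 <= t].

Let mD : measurable D.
Proof.
rewrite (_ : D = `[0, +oo[%classic); first exact: measurable_itv.
by apply/seteqP; split=> x; rewrite /D/= in_itv/= andbT.
Qed.

Let trunc_pow (x t : R) := trpow t (d - 1) x.

Lemma trunc_powE x t : trunc_pow x t = Num.max (1 - t * x) 0 ^+ (d - 1).
Proof. by rewrite trpow_maxE// subn_gt0. Qed.

Let measurable_trunc_pow x : measurable_fun D (trunc_pow x).
Proof.
rewrite (_ : trunc_pow x = fun t => Num.max (1 - t * x) 0 ^+ (d - 1)); last first.
  by apply/funext => t; rewrite trunc_powE.
apply: measurable_funX; apply: measurable_maxr => //.
by apply: measurable_funB => //; exact: measurable_funM.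
Qed.

Lemma integrable_trunc_pow x : 0 <= x -> gamma.-integrable D (EFin \o trunc_pow x).
Proof.
move=> x0; apply: measurable_bounded_integrable => //.
- by apply: (@le_lt_trans _ _ 1%E); [exact: probability_le1 | exact: ltry].
- exists 1; split=> // M M1 t /= t0; rewrite trunc_powE ger0_norm; last first.
    by rewrite exprn_ge0// le_max lexx orbT.
  rewrite (le_trans _ (ltW M1))// exprn_ile1// ?le_max ?lexx ?orbT//.
  by rewrite ge_max ler01 andbT gerBl mulr_ge0.
Qed.

Lemma integral_trunc_pow x : 0 <= x ->
  (\int[gamma]_(t in D) (trunc_pow x t)%:E = (psi x)%:E)%E.
Proof.
case: gammaP => gD _ gpsi.
(* The representation is assumed at positive arguments; at 0 the integrand is 1 and [gamma] has mass
   1 on the half-line. *)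
rewrite le_eqVlt => /predU1P[<-|x0].
  rewrite psi0// (eq_integral (cst 1%E)); last first.
    by move=> t _; rewrite trunc_powE mulr0 subr0 max_l ?expr1n.
  by rewrite integral_cst// mul1e.
by rewrite gpsi//; apply: eq_integral => t _; rewrite trunc_powE.
Qed.

Lemma integral_fdiff (h : R) n x : 0 <= h -> 0 <= x ->
  gamma.-integrable D (EFin \o fun t => fdiff h n (trpow t (d - 1)) x) /\
  (\int[gamma]_(t in D) (fdiff h n (trpow t (d - 1)) x)%:E = (fdiff h n psi x)%:E)%E.
Proof.
move=> h0; elim: n x => [|n IH] x x0.
  by split; [exact: integrable_trunc_pow | exact: integral_trunc_pow].
have [i1 e1] := IH x x0; have [i2 e2] := IH (x + h) (addr_ge0 x0 h0).
split.
  have := integrableB mD i1 i2; apply: eq_integrable => // t _ /=.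

by under eq_integral do rewrite /= EFinB; rewrite integralB_EFin// e1 e2.
Qed.

(* The set [E] is stated through the knots of the B-spline: only the cells [k]
   whose level [m = |k|] satisfies [t m h < 1 <= t (m + d) h] carry mass. *)
Lemma williamson_le_cells (h : R) M (A : pred nat) (E : set R) : 0 <= h ->
  measurable E ->
  (forall t, E t -> 0 <= t /\ 1 <= t * (M%:R * h)) ->
  (forall t m, E t -> t * (m%:R * h) < 1 -> 1 <= t * ((m + d)%:R * h) -> A m) ->
  (gamma E <= \sum_(k : {ffun 'I_d -> 'I_M} | A (\sum_i (k i : nat))%N)
     (fdiff h d psi ((\sum_i (k i : nat))%:R * h))%:E)%E.
Proof.
move=> h0 mE EM EA.
have mh0 m : 0 <= m%:R * h :> R by rewrite mulr_ge0.
pose F (k : {ffun 'I_d -> 'I_M}) (t : R) :=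
  fdiff h d (trpow t (d - 1)) ((\sum_i (k i : nat))%:R * h).
have dE : d = (d - 1).+1 by rewrite subn1 prednK// (ltn_trans _ d_gt1).
have F0 k t : 0 <= t -> 0 <= F k t.
  move=> t0; have := fdiff_trpow _ t h (d - 1) ((\sum_i (k i : nat))%:R * h) t0 h0.
  by rewrite -dE => -[].
under eq_bigr do rewrite -(integral_fdiff h d _ h0 (mh0 _)).2.
rewrite -(integral_sum mD (f := fun k t => (F k t)%:E)); last first.
  by move=> k; exact: (integral_fdiff h d _ h0 (mh0 _)).1.
have -> : gamma E = (\int[gamma]_(t in D) (\1_E t)%:E)%E.
  by rewrite integral_indic// setIidl// => t Et; have [] := EM t Et.
apply: ge0_le_integral => //.
- by apply/measurable_EFinP; exact: measurable_indic.
- have /integrableP[] := integrable_sum mD (index_enum _)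
    (P := fun k : {ffun 'I_d -> 'I_M} => A (\sum_i (k i : nat))%N)
    (fun k _ => (integral_fdiff h d _ h0 (mh0 (\sum_i (k i : nat))%N)).1).
  by [].
move=> t t0; rewrite sumEFin lee_fin indicE.
have [/set_mem Et|_] := boolP (t \in E); last by rewrite sumr_ge0// => k _; exact: F0.
have [_ tM] := EM t Et.
(* Cells outside [A] vanish at this [t], so the full sum may be used; it is 1 because [1 <= t M h]
   kills the truncated power from level [M] on. *)
suff -> : \sum_(k : {ffun 'I_d -> 'I_M} | A (\sum_i (k i : nat))%N) F k t = \sum_k F k t.
  rewrite /F sum_box_fdiff; first by rewrite /trpow mulr0 ltr01 subr0 expr1n.
  move=> m Mm; rewrite /trpow ltNge (le_trans tM)//.
  by rewrite ler_wpM2l// ler_wpM2r// ler_nat.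
rewrite [RHS](bigID (fun k : {ffun 'I_d -> 'I_M} => A (\sum_i (k i : nat))%N))/=.
rewrite [X in _ = _ + X]big1 ?addr0// => k /negP nA.
apply/eqP/negP => /negP Fk; apply: nA.
have [_ ] := fdiff_trpow _ t h (d - 1) ((\sum_i (k i : nat))%:R * h) t0 h0.
rewrite -dE => /(_ Fk)/andP[t1 t2]; apply: (EA t) => //.
by rewrite natrD mulrDl.
Qed.

Lemma williamson_pos : gamma `]0, +oo[%classic = 1%E.
Proof.
case: gammaP => gD g0 _.
have mP : measurable (`]0, +oo[%classic : set R) by exact: measurable_itv.
rewrite -[RHS]gD; have -> : [set t : R | 0 <= t] = `]0, +oo[%classic `|` [set 0].
  apply/seteqP; split=> x /=; rewrite in_itv/= andbT.
    by rewrite le_eqVlt => /predU1P[->|]; [right|left].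
  by move=> [/ltW|->].
by apply/esym; apply: measureU0.
Qed.

(** A nonnegative integrand with integral [psi r = 0] vanishes almost everywhere, yet this one is
    positive wherever [t r < 1]. *)
Lemma williamson_lt_zero r : 0 <= r -> psi r = 0 ->
  gamma [set t | 0 <= t /\ t * r < 1] = 0%E.
Proof.
move=> r0 pr.
have mf : measurable_fun D (EFin \o trunc_pow r).
  by have /integrableP[] := integrable_trunc_pow r r0.
have /(ae_eq_integral_abs _ mD mf)[N [mN N0 NE]] :
    (\int[gamma]_(t in D) `|(trunc_pow r t)%:E| = 0)%E.
  transitivity (\int[gamma]_(t in D) (trunc_pow r t)%:E)%E.
    2: by rewrite integral_trunc_pow// pr.
  apply: eq_integral => t _; rewrite /= trunc_powE ger0_norm//.
  by rewrite exprn_ge0// le_max lexx orbT.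
have mE : measurable [set t : R | 0 <= t /\ t * r < 1].
  rewrite (_ : mkset _ = D `&` (fun t => t * r) @^-1` `]-oo, 1[%classic).
    apply: measurableI => //; rewrite -[X in measurable X]setTI.
    have mr : measurable_fun setT (fun t : R => t * r) by exact: measurable_funM.
    by apply: mr => //; exact: measurable_itv.
  by apply/seteqP; split=> t /=; rewrite in_itv.
apply: (subset_measure0 mE mN _ N0) => t [t0 tr].
apply: NE => /= /(_ t0)[]; rewrite /trunc_pow /trpow tr => /eqP.
by rewrite expf_eq0 subr_eq0 gt_eqF// andbF.
Qed.

End Williamson.

(** * Mass of the grid cells under the copula measure *)

Lemma measurable_coord (R : realType) d (i : 'I_d) :
  measurable_fun setT (fun u : Rd R d => (u : 'I_d -> R) i).
Proof.
apply: (measurability (@measurable_realfun.RGenOInfty.G R)) => [|/= _ [_] [r] -> <-].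
  exact: measurable_realfun.RGenOInfty.measurableE.
rewrite setTI -[X in measurable X]setCK; apply: measurableC.
(* The half-space [u i <= r] is exhausted by the orthants whose other bounds are all [n]. *)
pose F (n : nat) : set (Rd R d) :=
  [set x : 'I_d -> R | forall j, x j <= if j == i then r else n%:R].
rewrite (_ : ~` _ = \bigcup_n F n); last first.
  apply/seteqP; split=> u /=; rewrite in_itv/= andbT.
    move=> /negP; rewrite -leNgt => ur.
    exists (Num.truncn (\sum_j `|(u : 'I_d -> R) j|)).+1 => // j.
    case: eqP => [->//|_]; apply/ltW/(le_lt_trans _ (truncnS_gt _)).
    by rewrite (le_trans (ler_norm _))// (bigD1 j)//= lerDl sumr_ge0.
  by move=> [n _ /(_ i)]; rewrite eqxx leNgt => /negP.
apply: bigcup_measurable => n _; apply: sub_sigma_algebra.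
by exists (fun j => if j == i then r else n%:R).
Qed.

Section CopulaMeasure.
Variables (R : realType) (d : nat) (psi : R -> R) (mu : probability (Rd R d) R).
Hypothesis psi_gen : is_generator psi.
Hypothesis muP : copula_measure d psi mu.

Lemma measurable_coord_set (i : 'I_d) (A : set R) : measurable A ->
  measurable ([set u | A (u i)] : set (Rd R d)).
Proof. by move=> mA; have := measurable_coord R d i measurableT A mA; rewrite setTI. Qed.

Lemma measurable_forall_coord (A : 'I_d -> set R) : (forall i, measurable (A i)) ->
  measurable ([set u | forall i, A i (u i)] : set (Rd R d)).
Proof.
move=> mA.
rewrite (_ : [set u | _] = \bigcap_(i in [set: 'I_d]) ([set u | A i (u i)] : set (Rd R d))).
  by apply: fin_bigcap_measurable => // i _; exact: measurable_coord_set.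
by apply/seteqP; split=> u /= h i => [_|]; apply: h.
Qed.

(* In the coordinates [x_j] with [u_j = psi x_j]: [a_j <= x_j < a_j + h] for [j < n]
   and [a_j <= x_j] for [j >= n]. *)
Definition cell (h : R) (n : nat) (a : 'I_d -> R) : set (Rd R d) :=
  [set u | forall j, 0 <= u j <= psi (a j) /\ ((j < n)%N -> psi (a j + h) < u j)].

Lemma measurable_cell h n a : measurable (cell h n a).
Proof.
apply: (measurable_forall_coord (fun j : 'I_d =>
  [set x | 0 <= x <= psi (a j) /\ ((j < n)%N -> psi (a j + h) < x)])) => j.
case: (ltnP j n) => jn.
  rewrite (_ : mkset _ = `[0, psi (a j)]%classic `&` `]psi (a j + h), +oo[%classic).
    by apply: measurableI; exact: measurable_itv.
  apply/seteqP; split=> x /=; rewrite !in_itv/= ?andbT.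
    by move=> [-> /(_ isT)].
  by move=> [-> ?].
rewrite (_ : mkset _ = `[0, psi (a j)]%classic); first exact: measurable_itv.
apply/seteqP; split=> x /=; rewrite !in_itv/= ?andbT.
  by move=> [->].
by move=> ->.
Qed.

(** Inclusion-exclusion one coordinate at a time: the strict bound on the next coordinate removes
    the same box with its corner moved by [h] there, which moves the corner sum by [h]. *)
Lemma mu_cell h n a : 0 <= h -> (forall j, 0 <= a j) -> (n <= d)%N ->
  mu (cell h n a) = (fdiff h n psi (\sum_j a j))%:E.
Proof.
move=> h0; elim: n a => [|n IH] a a0 nd.
  rewrite /= -arch_copula_psi//; case: muP => _ <-.
    by congr (mu _); apply/seteqP; split=> u /= hu j; [have [] := hu j|split; [exact: hu|]].
  by move=> j /=; rewrite psi_ge0//= psi_le1.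
pose i := Ordinal nd; pose b j := a j + (if j == i then h else 0).
have b0 j : 0 <= b j by rewrite /b; case: ifP => _; rewrite ?addr0// addr_ge0.
have -> : cell h n.+1 a = cell h n a `\` cell h n b.
  apply/seteqP; split=> u.
    move=> hu; split=> [j|/(_ i)[]].
      by have [h1 h2] := hu j; split=> // jn; apply: h2; rewrite ltnS ltnW.
    rewrite /b eqxx => /andP[_]; rewrite leNgt => /negP + _; apply.
    by have [_] := hu i; apply; rewrite /= ltnS.
  move=> [hu nhu] j; have [h1 h2] := hu j; split=> // jn.
  have [jn'|nj] := ltnP j n; first exact: h2.
  have ji : j = i by apply/val_inj/eqP; rewrite /= eqn_leq nj andbT -ltnS.
  rewrite ltNge; apply/negP => uj; apply: nhu => l; rewrite /b.
  have [li|_] := eqVneq l i; last by rewrite addr0; exact: hu.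
  rewrite li -ji uj; split; first by case/andP : h1 => ->.
  by rewrite ltnNge nj.
have ba : cell h n b `<=` cell h n a.
  move=> u hu j; have [/andP[h1 h2] h3] := hu j.
  have pba : psi (b j) <= psi (a j).
    by rewrite psi_noninc// /b; case: ifP => _; rewrite ?addr0// lerDl.
  split; first by rewrite h1 (le_trans h2).
  move=> jn; have := h3 jn; rewrite /b; case: eqP => [ji|_]; last by rewrite addr0.
  by move: jn; rewrite ji ltnn.
transitivity (mu (cell h n a) - mu (cell h n b))%E.
  rewrite -[in RHS](setIidr ba); apply: measureD; [exact: measurable_cell..|].
  apply: (@le_lt_trans _ _ 1%E); last exact: ltry.
  by apply: probability_le1; exact: measurable_cell.
rewrite !IH ?(ltnW nd)//= EFinB; congr (_ - (fdiff _ _ _ _)%:E)%E.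
by rewrite /b big_split/= -big_mkcond/= big_pred1_eq.
Qed.

Lemma cell_pos h a u : 0 <= h -> (forall j, 0 <= a j) -> cell h d a u ->
  forall j, 0 < u j <= 1.
Proof.
move=> h0 a0 hu j; have [/andP[u0 ua] /(_ (ltn_ord j)) pu] := hu j.
have p0 : 0 <= psi (a j + h) by rewrite psi_ge0// addr_ge0.
by rewrite (le_lt_trans p0 pu) (le_trans ua)// psi_le1.
Qed.

Definition psum (u : Rd R d) : R := \sum_i rphi R psi (u i).

Lemma measurable_psum : measurable_fun setT psum.
Proof.
apply: measurable_sum => i.
apply: (measurableT_comp (measurable_rphi R psi psi_gen)).
exact: measurable_coord.
Qed.

Lemma psum_ge0 u : 0 <= psum u.
Proof. by apply: sumr_ge0 => i _; exact: rphi_ge0. Qed.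

Lemma cell_psum h a u : 0 <= h -> (forall j, 0 <= a j) -> cell h d a u ->
  \sum_j a j <= psum u <= \sum_j a j + d%:R * h.
Proof.
move=> h0 a0 hu; have upos := cell_pos h a u h0 a0 hu.
apply/andP; split.
  by apply: ler_sum => j _; rewrite le_rphi//; have [/andP[]] := hu j.
have -> : d%:R * h = \sum_(j < d) h by rewrite sumr_const card_ord mulr_natl.
rewrite -big_split/=; apply: ler_sum => j _.
have [_ /(_ (ltn_ord j))] := hu j; rewrite ltNge; apply: contraNle => ah.
by rewrite -le_rphi// ?addr_ge0// ltW.
Qed.

Let grid (h : R) M (k : {ffun 'I_d -> 'I_M}) (j : 'I_d) : R := (k j : nat)%:R * h.

Lemma cell_disjoint h M : 0 <= h ->
  trivIset setT (fun k : {ffun 'I_d -> 'I_M} => cell h d (grid h M k)).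
Proof.
move=> h0 k l _ _ [u [uk ul]]; apply/ffunP => j.
(* If [k1 j < k2 j], the bounds [psi ((k1 j + 1) h) < u j <= psi (k2 j h)] contradict the
   monotonicity of [psi]. *)
have sep (k1 k2 : {ffun 'I_d -> 'I_M}) : cell h d (grid h M k1) u ->
    cell h d (grid h M k2) u -> ~~ (k1 j < k2 j)%N.
  move=> u1 u2; apply/negP => k12.
  have [_ /(_ (ltn_ord j))] := u1 j; have [/andP[_ +] _] := u2 j.
  move=> uk2; apply/negP; rewrite -leNgt (le_trans uk2)// psi_noninc//.
    by rewrite addr_ge0// mulr_ge0.
  by rewrite /grid -[X in _ + X]mul1r -mulrDl natr1 ler_wpM2r// ler_nat.
apply/val_inj/eqP; rewrite eqn_leq leqNgt (sep _ _ ul uk) leqNgt.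
by rewrite (sep _ _ uk ul).
Qed.

(** Counterpart of [williamson_le_cells] on the copula side: the same sum of differences is the
    [mu]-mass of a disjoint union of cells. *)
Lemma sum_cells_le h M (A : pred nat) (B : set (Rd R d)) : 0 <= h ->
  measurable B ->
  (forall k : {ffun 'I_d -> 'I_M}, A (\sum_i (k i : nat))%N ->
     cell h d (grid h M k) `<=` B) ->
  (\sum_(k : {ffun 'I_d -> 'I_M} | A (\sum_i (k i : nat))%N)
     (fdiff h d psi ((\sum_i (k i : nat))%:R * h))%:E <= mu B)%E.
Proof.
move=> h0 mB AB.
pose r := enum [pred k : {ffun 'I_d -> 'I_M} | A (\sum_i (k i : nat))%N].
have rE k : k \in r = A (\sum_i (k i : nat))%N by rewrite mem_enum.
have -> : (\sum_(k : {ffun 'I_d -> 'I_M} | A (\sum_i (k i : nat))%N)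
     (fdiff h d psi ((\sum_i (k i : nat))%:R * h))%:E =
   mu (\bigcup_(k in [set` r]) cell h d (grid h M k)))%E.
  rewrite measure_fin_bigcup//.
  - rewrite -fsbig_seq ?enum_uniq// big_enum; apply: eq_bigr => k _.
    have -> : (\sum_i (k i : nat))%:R * h = \sum_j grid h M k j.
      by rewrite /grid -mulr_suml natr_sum.
    by apply/esym; apply: mu_cell => // j; rewrite mulr_ge0.
  - exact: sub_trivIset (cell_disjoint h M h0).
  - by move=> k _; exact: measurable_cell.
apply: le_measure; rewrite ?inE//.
  by apply: fin_bigcup_measurable => // k _; exact: measurable_cell.
by move=> u [k kr]; apply: (AB k); rewrite -rE.
Qed.

Definition boundary : set (Rd R d) := [set u | unit_cube d u /\ exists i, u i = 0].

(** The face [u i = 0] is itself a box from the origin, whose mass is [C] at an upper corner with a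
    zero coordinate. *)
Lemma boundary_null : measurable boundary /\ mu boundary = 0%E.
Proof.
pose e (i j : 'I_d) : R := if j == i then 0 else 1.
pose N (i : 'I_d) : set (Rd R d) := [set x | forall j, 0 <= x j <= e i j].
have -> : boundary = \big[setU/set0]_(i < d) N i.
  rewrite -bigcup_seq; apply/seteqP; split=> u /=.
    move=> [hu [i ui]]; exists i; first by rewrite /= mem_index_enum.
    move=> j; rewrite /e; case: eqP => [->|_]; last exact: hu.
    by rewrite ui lexx.
  move=> [i _ hu]; split=> [j|].
    have /andP[-> uj]/= := hu j; rewrite (le_trans uj)// /e.
    by case: ifP.
  by exists i; have := hu i; rewrite /e eqxx => /le_anti.
apply: (big_ind (fun A : set (Rd R d) => measurable A /\ mu A = 0%E)).
- by rewrite measure0.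
- move=> A B [mA A0] [mB B0]; split; first exact: measurableU.
  by rewrite measureU0.
move=> i _; split.
  apply: (measurable_forall_coord (fun j => [set x | 0 <= x <= e i j])) => j.
  rewrite (_ : mkset _ = `[0, e i j]%classic); first exact: measurable_itv.
  by apply/seteqP; split=> x /=; rewrite in_itv.
case: muP => _ ->; first by rewrite (arch_copula_eq0 _ _ psi_gen _ _ i)// /e eqxx.
by move=> j; rewrite /e; case: ifP => _; rewrite ?lexx ler01.
Qed.

Definition open_cube : set (Rd R d) := [set u | forall i, 0 < u i <= 1].

Lemma measurable_open_cube : measurable open_cube.
Proof.
apply: (measurable_forall_coord (fun=> [set x | 0 < x <= 1])) => i.
rewrite (_ : mkset _ = `]0, 1]%classic); first exact: measurable_itv.
by apply/seteqP; split=> x /=; rewrite in_itv.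
Qed.

End CopulaMeasure.

(** * The law of the sum of the generator coordinates *)

Section Main.
Variables (R : realType) (d : nat) (psi : R -> R).
Variables (gamma : probability R R) (mu : probability (Rd R d) R).
Hypothesis d_gt1 : (1 < d)%N.
Hypothesis psi_gen : is_generator psi.
Hypothesis gammaP : williamson_measure d psi gamma.
Hypothesis muP : copula_measure d psi mu.

(* [powR] rather than [GRing.inv] because its measurability is in the library; the two
   agree on the positive half-line, which carries [gamma]. *)
Let recip (t : R) : R := t `^ (-1).

Let recipE t : 0 < t -> recip t = t^-1.
Proof. by move=> t0; rewrite /recip powR_inv1// ltW. Qed.

Let measurable_recip : measurable_fun setT recip.
Proof. exact: measurable_powR. Qed.

(** [P] is the law of [Z] under [mu] and [Q] that of [1/t] under [gamma]; the goal is that they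
    coincide. *)
Let P : probability R R :=
  distribution mu (mfun_Sub (mem_set (measurable_psum R d psi psi_gen))).
Let Q : probability R R := distribution gamma (mfun_Sub (mem_set measurable_recip)).

Let PE A : P A = mu (psum R d psi @^-1` A). Proof. by []. Qed.

Let QE A : measurable A -> Q A = gamma ([set t | A t^-1] `&` `]0, +oo[%classic).
Proof.
move=> mA.
have -> : Q A = gamma (recip @^-1` A) by [].
rewrite (probability_setI_full _ _ _ gamma `]0, +oo[%classic)//.
- congr (gamma _); apply/seteqP; split=> t /=; rewrite in_itv/= andbT.
    by move=> [? t0]; rewrite -recipE.
  by move=> [? t0]; rewrite recipE.
- by have := measurable_recip measurableT A mA; rewrite setTI.
- exact: williamson_pos gammaP.
Qed.

Let measurable_Q_set A : measurable A ->
  measurable ([set t : R | A t^-1] `&` `]0, +oo[%classic).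
Proof.
move=> mA; rewrite (_ : _ `&` _ = (recip @^-1` A) `&` `]0, +oo[%classic).
  by apply: measurableI => //; have := measurable_recip measurableT A mA; rewrite setTI.
apply/seteqP; split=> t /=; rewrite in_itv/= andbT.
  by move=> [? t0]; rewrite recipE.
by move=> [? t0]; rewrite -recipE.
Qed.

(* [A] selects the levels [m] of a grid of mesh [h] whose B-splines can charge [B]. *)
Let law_transfer (B B' : set R) (h : R) M (A : pred nat) : 0 < h ->
  measurable B -> measurable B' -> B `<=` `]-oo, (M%:R * h)%R]%classic ->
  (forall w m, B w -> m%:R * h < w -> w <= (m + d)%:R * h -> A m) ->
  (forall (m : nat) z, A m -> m%:R * h <= z <= m%:R * h + d%:R * h -> B' z) ->
  (Q B <= P B')%E.
Proof.
move=> h0 mB mB' BM BA AB'.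
rewrite QE// PE.
(* Both laws are compared with one sum of differences of [psi] over the selected cells. *)
apply: (@le_trans _ _ (\sum_(k : {ffun 'I_d -> 'I_M} | A (\sum_i (k i : nat))%N)
     (fdiff h d psi ((\sum_i (k i : nat))%:R * h))%:E)%E).
  apply: (williamson_le_cells R d psi gamma d_gt1 psi_gen gammaP) => //.
  - exact: ltW.
  - exact: measurable_Q_set.
  - move=> t [/= Bt]; rewrite in_itv/= andbT => t0; split; first exact: ltW.
    have /= := BM _ Bt; rewrite in_itv/= => tM.
    by rewrite mulrC -ler_pdivrMr// mul1r.
  - move=> t m [/= Bt]; rewrite in_itv/= andbT => t0 tm tmd; apply: (BA t^-1) => //.
      by rewrite -[ltRHS]mul1r ltr_pdivlMr// mulrC.
    by rewrite -[leLHS]mul1r ler_pdivrMr// mulrC.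
apply: (sum_cells_le R d psi mu psi_gen muP); first exact: ltW.
  by have := measurable_psum R d psi psi_gen measurableT B' mB'; rewrite setTI.
move=> k Ak u uk /=; apply: (AB' _ _ Ak).
have := cell_psum R d psi psi_gen h _ u (ltW h0) _ uk.
rewrite -mulr_suml natr_sum; apply => j.
by rewrite mulr_ge0// ltW.
Qed.

(** [law_transfer] only bounds [Q] by [P], and with a loss [h]. Upper rays give one inequality;
    lower rays, after complementation, give the other. *)
Lemma psum_law (A : set R) : measurable A ->
  mu (psum R d psi @^-1` A) = gamma ([set t | A t^-1] `&` `]0, +oo[%classic).
Proof.
have d0 : 0 < d%:R :> R by rewrite ltr0n (ltn_trans _ d_gt1).
move=> mA; rewrite -QE// -PE; apply: eq_probability_upper => // s.
apply/eqP; rewrite eq_le; apply/andP; split; last first.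
  apply: probability_upper_le => {}s h h0.
  (* With mesh [h / d] the coordinate sum varies by at most [d] meshes, that is [h], on a cell. *)
  have hd0 : 0 < h / d%:R by rewrite divr_gt0.
  apply: (probability_le_truncated _ _ _ _ _ hd0) => // N.
  apply: (law_transfer _ _ _ N (fun m => s - h <= m%:R * (h / d%:R)) hd0).
  - by apply: measurableI; exact: measurable_itv.
  - exact: measurable_itv.
  - by move=> w [].
  - move=> w m [/=]; rewrite in_itv/= andbT => sw _ _; rewrite natrD mulrDl.
    rewrite [d%:R * _]mulrC divfK ?gt_eqF// => wm.
    by rewrite lerBlDr (le_trans sw).
  - by move=> m z sm /andP[mz _]; rewrite /= in_itv/= andbT (le_trans sm).
apply: probability_upper_le => {}s h h0.
have hd0 : 0 < h / d%:R by rewrite divr_gt0.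
have compl (S : probability R R) x : S `[x, +oo[%classic = (1 - S `]-oo, x[%classic)%E.
  by rewrite -probability_setC ?setCitvl//; exact: measurable_itv.
rewrite !compl leeB//.
have [N sN] : exists N : nat, s <= N%:R * (h / d%:R).
  exists (Num.truncn (s / (h / d%:R))).+1.
  by rewrite -ler_pdivrMr// ltW// truncnS_gt.
apply: (law_transfer _ _ _ N
  (fun m => m%:R * (h / d%:R) + d%:R * (h / d%:R) < s) hd0).
- exact: measurable_itv.
- exact: measurable_itv.
- move=> w /=; rewrite !in_itv/= => /ltW ws.
  by rewrite (le_trans _ sN)// (le_trans ws)// gerBl ltW.
- move=> w m /=; rewrite in_itv/= => ws mw _.
  by rewrite [d%:R * _]mulrC divfK ?gt_eqF// -ltrBrDr (lt_trans mw).
- by move=> m z sm /andP[_ mz]; rewrite /= in_itv/= (le_lt_trans mz).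
Qed.

(** * Events on the value of the copula as events on [Z] *)

Local Notation Z := (psum R d psi).
Local Notation open_cube := (open_cube R d).
Local Notation boundary := (boundary R d).

Lemma unit_cubeE : unit_cube d = open_cube `|` boundary :> set (Rd R d).
Proof.
apply/seteqP; split=> u /=.
  move=> hu; have [/forallP pos|] := boolP [forall i, 0 < u i].
    by left=> i; rewrite pos; case/andP : (hu i).
  rewrite negb_forall => /existsP[i]; rewrite -leNgt => ui; right; split=> //.
  by exists i; apply/le_anti; rewrite ui; case/andP : (hu i).
by move=> [hu i|[]//]; case/andP : (hu i) => /ltW -> ->.
Qed.

Lemma mu_open_cubeI (A : set (Rd R d)) : measurable A -> mu (open_cube `&` A) = mu A.
Proof.
move=> mA; have mO := measurable_open_cube R d.
have [mB B0] := boundary_null R d psi mu psi_gen muP.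
rewrite setIC -probability_setI_full//.
by case: muP => <- _; rewrite unit_cubeE measureU0.
Qed.

Lemma arch_copula_open u : open_cube u -> arch_copula d psi u = psi (Z u).
Proof.
move=> hu; rewrite -arch_copula_psi// => [|i]; last exact: rphi_ge0.
by congr (arch_copula d psi _); apply/funext => i /=; have [] := rphiP R psi psi_gen _ (hu i).
Qed.

Lemma arch_copula_boundary u : boundary u -> arch_copula d psi u = 0.
Proof. by move=> [_ [i ui]]; exact: arch_copula_eq0 ui. Qed.

Lemma measurable_psum_preimage A : measurable A -> measurable (Z @^-1` A).
Proof.
by move=> mA; have := measurable_psum R d psi psi_gen measurableT A mA; rewrite setTI.
Qed.

(** Off the null boundary [C(U) = psi(Z)], so an event on the value of [C] becomes an event on [Z],
    to which [psum_law] applies. *)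
Lemma mu_unit_cube_pred (p : R -> Prop) (A : set R) : measurable A ->
  (forall z, 0 <= z -> p (psi z) <-> A z) ->
  mu [set u | unit_cube d u /\ p (arch_copula d psi u)] =
    gamma ([set t | A t^-1] `&` `]0, +oo[%classic).
Proof.
move=> mA pA; have mZA := measurable_psum_preimage _ mA.
have [mB B0] := boundary_null R d psi mu psi_gen muP.
rewrite -psum_law// -[RHS]mu_open_cubeI//.
have E : open_cube `&` Z @^-1` A =
    open_cube `&` [set u | p (arch_copula d psi u)].
  apply/seteqP; split=> u [hu /= Au]; split=> //=.
    by rewrite arch_copula_open//; apply/pA => //; exact: psum_ge0.
  by apply/pA; rewrite -?arch_copula_open//; exact: psum_ge0.
have mO := measurable_open_cube R d.
have mE : measurable (open_cube `&` Z @^-1` A) by exact: measurableI.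
(* [C] is 0 on the boundary, so the event contains all of it or none of it. *)
have [p0|np0] := pselect (p 0).
  transitivity (mu ((open_cube `&` Z @^-1` A) `|` boundary)); last by apply: measureU0.
  congr (mu _); rewrite E; apply/seteqP; split=> u /=.
    move=> [hu pu]; have : unit_cube d u by [].
    by rewrite unit_cubeE => -[|]; [left|right].
  move=> [[hu pu]|bu].
    by split=> //; rewrite unit_cubeE; left.
  by split; [case: bu|rewrite arch_copula_boundary].
congr (mu _); rewrite E; apply/seteqP; split=> u /=.
  move=> [hu pu]; split=> //; move: hu; rewrite unit_cubeE => -[//|].
  by move=> /arch_copula_boundary u0; move: pu; rewrite u0.
by move=> [hu pu]; split=> //; rewrite unit_cubeE; left.
Qed.

End Main.

(** * Level sets and the Kendall distribution function *)

Theorem theorem5p5 (R : realType) (d : nat) (psi : R -> R)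
  (gamma : probability R R) (mu : probability (Rd R d) R) :
  (3 <= d)%N ->
  is_generator psi ->
  archimedean_copula_cond d psi ->
  williamson_measure d psi gamma ->
  copula_measure d psi mu ->
  [/\ (forall t : R, 0 < t <= 1 ->
         mu (level_set d psi t) = gamma [set r : R | r%:E = einv (phi psi t)]),
      (strict psi -> mu (level_set d psi 0) = 0%E),
      (~ strict psi ->
         mu (level_set d psi 0) = gamma [set r : R | r%:E = einv (phi psi 0)])
    & (forall t : R, 0 < t <= 1 ->
         kendall_df d psi mu t = gamma [set r : R | 0 <= r /\ (r%:E <= einv (phi psi t))%E])].
Proof.
move=> d3 psi_gen _ gammaP muP.
have d1 : (1 < d)%N by apply: leq_trans d3.
have gpos := williamson_pos R d psi gamma gammaP.
have law := mu_unit_cube_pred R d psi gamma mu d1 psi_gen gammaP muP.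
have mpos : measurable (`]0, +oo[%classic : set R) by exact: measurable_itv.
have posI (A : set R) : measurable A -> gamma A = gamma (A `&` `]0, +oo[%classic).
  by move=> mA; exact: probability_setI_full.
have phiE t : 0 < t <= 1 -> exists r, [/\ 0 <= r, phi psi t = r%:E & psi r = t].
  move=> t01; have [pt pr] := rphiP R psi psi_gen t t01.
  by exists (rphi R psi t); split=> //; exact: rphi_ge0.
have upperE t r z : 0 < t -> 0 <= r -> psi r = t -> 0 <= z ->
    psi z <= t <-> `[r, +oo[%classic z.
  move=> t0 r0 pr z0; rewrite /= in_itv/= andbT; split=> [pz|rz]; last first.
    by rewrite -pr psi_noninc.
  rewrite leNgt; apply/negP => zr.
  have pz0 : 0 < psi z by rewrite (lt_le_trans t0)// -pr psi_noninc// ltW.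
  by have := psi_decr R psi psi_gen z r z0 zr pz0; rewrite pr ltNge pz.
split.
- move=> t t01; have [r [r0 pt pr]] := phiE t t01; have /andP[t0 _] := t01.
  rewrite (law (eq^~ t) [set r]) ?pt; [|exact: measurable_set1|]; last first.
    move=> z z0; split=> [pz|-> //]; apply: (psi_inj R psi psi_gen) => //.
      by rewrite pz.
    by rewrite pz pr.
  rewrite [RHS]posI; last first.
    (* When [r = 0], that is [t = 1], [einv] is infinite and no real [r] meets the condition: the
       target set is empty. *)
    rewrite /einv/=; case: ifP => _.
      by rewrite (_ : mkset _ = set0)//; apply/seteqP; split.
    rewrite (_ : mkset _ = [set r^-1]); first exact: measurable_set1.
    by apply/seteqP; split=> x /=; [case|move=> ->].
  congr (gamma _); apply/seteqP; split=> x /=; rewrite in_itv/= andbT => -[xr x0].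
    by rewrite -xr invr_eq0 gt_eqF// invrK.
  by split=> //; move: xr; case: eqP => // _ [->]; rewrite invrK.
- move=> str; rewrite (law (eq^~ 0) set0)//.
    by rewrite set0I measure0.
  move=> z z0; split=> // pz.
  by have := phi0_pinftyE R psi psi_gen z str z0; rewrite pz ltxx.
- move=> nstr.
  have [r pr] : exists r, phi psi 0 = r%:E.
    move: nstr (phi_ge0 R psi 0); rewrite /strict.
    by case: (phi psi 0) => [r| |]//; exists r.
  have [r0 p0] := phi0_finE R psi psi_gen r pr.
  rewrite (law (eq^~ 0) `[r, +oo[%classic); [|exact: measurable_itv|]; last first.
    move=> z z0; rewrite /= in_itv/= andbT; split=> [pz|rz].
      by rewrite -lee_fin -pr; apply: ge_ereal_inf; exists z%:E => //; exists z.
    by apply/eqP; rewrite eq_le psi_ge0// andbT -[leRHS]p0 psi_noninc// ltW.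
  have mE : measurable [set t : R | 0 <= t /\ t * r < 1].
    rewrite (_ : mkset _ = `[0, r^-1[%classic); first exact: measurable_itv.
    apply/seteqP; split=> x /=; rewrite in_itv/= -[r^-1]mul1r ltr_pdivlMr//.
      by move=> [-> ->].
    by move=> /andP[].
  (* [C = 0] means [Z >= r], so [law] yields the mass of []0, 1/r]]; the part below [1/r] is null
     because [psi r = 0], leaving the atom. *)
  have g0 := williamson_lt_zero R d psi gamma d1 psi_gen gammaP r (ltW r0) p0.
  rewrite pr /= gt_eqF// (_ : [set x | x%:E = _] = [set r^-1]); last first.
    by apply/seteqP; split=> x /=; [case|move=> ->].
  rewrite -[RHS](measureU0 (measurable_set1 _) mE g0) [RHS]posI; last first.
    by apply: measurableU => //; exact: measurable_set1.
  congr (gamma _); apply/seteqP; split=> x /=; rewrite !in_itv/= !andbT => -[xr x0].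
    split=> //; move: xr; rewrite invf_pge ?posrE// le_eqVlt.
    move=> /predU1P[|xr]; [by left | right; split; first exact: ltW].
    by rewrite -ltr_pdivlMr// mul1r.
  split=> //; rewrite invf_pge ?posrE//; move: xr => [->//|[_]].
  by rewrite -ltr_pdivlMr// mul1r => /ltW.
- move=> t t01; have [r [r0 pt pr]] := phiE t t01; have /andP[t0 _] := t01.
  rewrite /kendall_df (law (fun y => y <= t) `[r, +oo[%classic);
    [|exact: measurable_itv|]; last first.
    by move=> z z0; exact: upperE.
  (* The case [r = 0], that is [t = 1], has an infinite bound and gives the whole half-line. *)
  rewrite pt /einv; case: eqP => [->|/eqP r_neq0].
    rewrite [RHS]posI.
      congr (gamma _); apply/seteqP; split=> x /=; rewrite !in_itv/= !andbT => -[_ x0].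
        by rewrite leey ltW.
      by rewrite invr_ge0 ltW.
    rewrite (_ : mkset _ = `[0, +oo[%classic); first exact: measurable_itv.
    by apply/seteqP; split=> x /=; rewrite in_itv/= andbT ?leey//; case.
  have rp : 0 < r by rewrite lt_neqAle eq_sym r_neq0.
  rewrite [RHS]posI.
    congr (gamma _); apply/seteqP; split=> x /=; rewrite !in_itv/= !andbT lee_fin => -[xr x0].
      by rewrite (ltW x0) -invf_pge ?posrE.
    by case: xr => _ xr; rewrite invf_pge ?posrE.
  rewrite (_ : mkset _ = `[0, r^-1]%classic); first exact: measurable_itv.
  by apply/seteqP; split=> x /=; rewrite in_itv/= lee_fin; [case=> -> ->|move/andP].
Qed.
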